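(* Let $M$ be a monoid and $\mathcal{P}(M)$ the corresponding free quantale. Let $\mathbf{c}:M\to(\mathbb{R},+)$ be a strong monoidal functor, and $\mathbf{C}:\mathcal{P}(M)\to(\mathbb{R},+)$ the corresponding induced strong monoidal functor. Let $X$ be an automaton with inputs from $M$, i.e. a $\mathcal{P}(M)$-category, with finitely many objects, and let $\mathbf{C}(X)$ be the corresponding $(\mathbb{R},+)$-category. Suppose that $\mathbf{C}(X)$ is strict (i.e. there is no pair of distinct states of $X$ connected by a $0$-cost transition), and let $r>0$. (1) If $(a,b)$ is a generator of $\mathcal{H}_1(\mathbf{C}(X))(r)$, then there is at least one state transition $m$ taking $a$ to $b$ which does not occur as a composite of state transitions, and the cost of $m$ is strictly less than the cost of any such composite transition. (2) If additionally $\mathbf{c}$ has discrete range, then the converse is true: for $(a,b)$ with $\mathbf{C}(X)(a,b)=r$, if there is at least one $m\in X(a,b)$ such that $\mathbf{c}(m)$ is less than the cost of all possible composite transitions from $a$ to $b$, then $(a,b)$ is cost-primitive and thus a generator of $\mathcal{H}_1(\mathbf{C}(X))(r)$.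
   Context: $\mathbb{R}$ denotes the extended nonnegative reals $0\le r\le\infty$ (as a poset category with the reverse of the usual order; $\mathbb{R}^{\mathrm{op}}$ has the usual order). $\mathcal{P}(M)$ is the poset of subsets of $M$ with $A\otimes B=\{a\cdot b\mid a\in A,b\in B\}$ and unit $\{e\}$, where $e$ is the identity element of $M$. A $\mathcal{P}(M)$-category $X$ (nondeterministic automaton with inputs from $M$) consists of a set of objects (states) and, for each ordered pair of states, a subset $X(a,b)\subseteq M$ (the transitions taking $a$ to $b$), such that $e\in X(a,a)$, and $m_2\cdot m_1\in X(a,b)$ whenever $m_1\in X(a,c)$, $m_2\in X(c,b)$. Regard $M$ as a monoidal category with only identity arrows. A strong monoidal functor $\mathbf{c}:M\to(\mathbb{R},+)$ is a function $\mathbf{c}:M\to[0,\infty]$ with $\mathbf{c}(m_2\cdot m_1)=\mathbf{c}(m_2)+\mathbf{c}(m_1)$ and $\mathbf{c}(e)=0$; $\mathbf{c}(m)$ is the cost of $m$. The induced $\mathbf{C}$ is $\mathbf{C}(A)=\inf_{a\in A}\mathbf{c}(a)$ (with $\mathbf{C}(\emptyset)=\infty$). $\mathbf{C}(X)$ is the $(\mathbb{R},+)$-category with the same objects as $X$ and $\mathbf{C}(X)(a,b)=\mathbf{C}(X(a,b))$; it satisfies $\mathbf{C}(X)(a,a)=0$ and the triangle inequality for $+$. It is strict if $\mathbf{C}(X)(a,b)=0$ implies $a=b$. A composite transition from $a$ to $b$ is an element $m_2\cdot m_1$ with $m_1\in X(a,c)$, $m_2\in X(c,b)$ for some intermediate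 state $c\ne a,b$; its cost is $\mathbf{c}(m_2\cdot m_1)=\mathbf{c}(m_1)+\mathbf{c}(m_2)$. An ordered pair $(a,b)$ of distinct states is cost-primitive if there is no state $c\neq a,b$ such that $\mathbf{C}(X)(a,b)=\mathbf{C}(X)(a,c)+\mathbf{C}(X)(c,b)$. $\mathbf{c}$ has discrete range if there is no $t\in\mathbb{R}$ that is the infimum of a (nonempty) set of values of $\mathbf{c}$ and lies outside the image of $\mathbf{c}$. $\mathcal{H}_\bullet$ is magnitude homology: for an $(\mathbb{R},+)$-category $Y$ (distances $Y(a,b)\in[0,\infty]$ with $Y(a,a)=0$ and the triangle inequality), $\mathcal{H}_\bullet(Y)(r)$ is the homology of the normalized Moore complex (quotient by degenerate elements, differential the alternating sum of faces) of the simplicial abelian group whose degree $n$ part is free abelian on the tuples $(x_0,\dots,x_n)$ with $\sum_{i=1}^nY(x_{i-1},x_i)=r$, where faces omit and degeneracies repeat vertices, and faces whose length is not $r$ are set to $0$. For $r>0$, a pair $(a,b)$ is called a generator of $\mathcal{H}_1(Y)(r)$ if $a\ne b$, $Y(a,b)=r$, and the class of the $1$-cycle $(a,b)$ in $\mathcal{H}_1(Y)(r)$ is nonzero.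
   Formalization: Here r is positive and finite (both parts fail at r = ∞), and ''discrete range'' means every nonempty set of values of c contains its infimum; with the infimum merely in the image of c, part (2) is false. *)

(* Defs.v *)
From HB Require Import structures.
From mathcomp Require Import all_boot all_order all_algebra.
From mathcomp Require Import boolp classical_sets reals ereal.
From mathcomp Require Import zify.

Set Implicit Arguments.
Unset Strict Implicit.
Unset Printing Implicit Defensive.

Import Order.TTheory GRing.Theory Num.Theory.
Local Open Scope classical_set_scope.
Local Open Scope ring_scope.
Local Open Scope quotient_scope.

(* Distances take values in [0, +oo], rendered as the nonnegative part of
   [\bar R]. *)
Record rcat (R : realType) (V : Type) := RCat {
  dist :> V -> V -> \bar R;
  dist_ge0 : forall a b, (0 <= dist a b)%E;
  dist_refl : forall a, dist a a = 0%E;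
  dist_triangle : forall a b c, (dist a b <= dist a c + dist c b)%E }.

Definition strict (R : realType) (V : Type) (Y : rcat R V) : Prop :=
  forall a b, Y a b = 0%E -> a = b.

Definition cost_primitive (R : realType) (V : Type) (Y : rcat R V) (a b : V) :
    Prop :=
  a <> b /\
  ~ exists c, [/\ c <> a, c <> b & Y a b = (Y a c + Y c b)%E].

Definition quantale_mul (M : monoidType) (A B : set M) : set M :=
  [set m | exists a b, [/\ A a, B b & m = (a * b)%g]].

(* The diagrammatic composite "first m1, then m2" is the product [m2 * m1]. *)
Record automaton (M : monoidType) (V : Type) := Automaton {
  trans :> V -> V -> set M;
  trans_id : forall a, trans a a 1%g;
  trans_comp : forall a b c,
    quantale_mul (trans c b) (trans a c) `<=` trans a b }.

Definition composite (M : monoidType) (V : Type) (X : automaton M V)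
    (a b : V) : set M :=
  [set m | exists c m1 m2,
     [/\ c <> a, c <> b, X a c m1, X c b m2 & m = (m2 * m1)%g]].

Record cost_functor (R : realType) (M : monoidType) := CostFunctor {
  cost :> M -> \bar R;
  cost_ge0 : forall m, (0 <= cost m)%E;
  cost1 : cost 1%g = 0%E;
  costM : forall m2 m1, cost (m2 * m1)%g = (cost m2 + cost m1)%E }.

(* Infima of values are attained: each nonempty set of values of [c] contains
   its infimum. Requiring only that the infimum be a value of [c] at some other
   element of [M] would make the notion vacuous for surjective [c], e.g. for
   the identity of ([0, +oo], +). *)
Definition discrete_range (R : realType) (M : monoidType)
    (c : cost_functor R M) : Prop :=
  ~ exists (t : \bar R) (S : set (\bar R)),
      [/\ S !=set0, S `<=` range c, t = ereal_inf S & ~ S t].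

Definition induced (R : realType) (M : monoidType) (c : cost_functor R M)
    (A : set M) : \bar R :=
  ereal_inf (c @` A).

Section InducedTheory.
Variables (R : realType) (M : monoidType) (c : cost_functor R M).
Local Open Scope ereal_scope.

Lemma induced_ge0 (A : set M) : 0 <= induced c A.
Proof. by apply: le_ereal_inf_tmp => _ [m _ <-]; exact: cost_ge0. Qed.

Lemma induced_le (A : set M) m : A m -> induced c A <= c m.
Proof. by move=> Am; apply: ereal_inf_lbound; exists m. Qed.

Lemma induced1 : induced c [set 1%g] = 0.
Proof. by rewrite /induced image_set1 ereal_inf1 cost1. Qed.

Lemma inducedM (A B : set M) :
  induced c (quantale_mul A B) = induced c A + induced c B.
Proof.
apply/eqP; rewrite eq_le; apply/andP; split; last first.
  apply: le_ereal_inf_tmp => _ [_ [a [b [Aa Bb ->]]] <-].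
  by rewrite costM; apply: leeD; exact: induced_le.
have fin_or (x : \bar R) : 0 <= x -> x = +oo \/ x \is a fin_num.
  by case: x => [x| |] //; [right | left].
case: (fin_or _ (induced_ge0 A)) => [->|finA].
  by rewrite addye ?leey // gt_eqF // (lt_le_trans _ (induced_ge0 B)).
case: (fin_or _ (induced_ge0 B)) => [->|finB].
  by rewrite addey ?leey // gt_eqF // (lt_le_trans _ (induced_ge0 A)).
apply/lee_addgt0Pr => e e0.
have e20 : (0 < e / 2)%R by rewrite divr_gt0.
have [_ [a Aa <-] lta] := lb_ereal_inf_adherent e20 finA.
have [_ [b Bb <-] ltb] := lb_ereal_inf_adherent e20 finB.
apply: (@le_trans _ _ (c (a * b)%g)); first by apply: induced_le; exists a, b.
rewrite costM (splitr e) EFinD addeACA.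
by apply: leeD; apply: ltW.
Qed.

Lemma le_induced (A B : set M) : A `<=` B -> induced c B <= induced c A.
Proof. by move=> AB; apply: ereal_inf_le_tmp; exact: image_subset. Qed.

Variables (V : Type) (X : automaton M V).

Lemma induced_refl a : induced c (X a a) = 0.
Proof.
apply/eqP; rewrite eq_le induced_ge0 andbT -induced1.
by apply: le_induced => _ ->; exact: trans_id.
Qed.

Lemma induced_triangle a b d :
  induced c (X a b) <= induced c (X a d) + induced c (X d b).
Proof. by rewrite addeC -inducedM; apply: le_induced; exact: trans_comp. Qed.

Definition induced_rcat : rcat R V :=
  RCat (fun a b => induced_ge0 (X a b)) induced_refl induced_triangle.

End InducedTheory.

Section Homology.
Variables (A B C : zmodType) (f : {additive A -> B}) (g : {additive B -> C}).

Definition cycle_pred : {pred B} := fun z => g z == 0.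

Fact cycle_pred_closed : zmod_closed cycle_pred.
Proof.
split=> [|x y]; rewrite !unfold_in ?raddf0 //.
by move=> /eqP x0 /eqP y0; rewrite raddfB x0 y0 subrr.
Qed.
HB.instance Definition _ := GRing.isZmodClosed.Build B cycle_pred
  cycle_pred_closed.

Record cycle := Cycle { cycle_val :> B; cycleP : cycle_val \in cycle_pred }.
HB.instance Definition _ := [isSub for cycle_val].
HB.instance Definition _ := [Choice of cycle by <:].
HB.instance Definition _ := [SubChoice_isSubZmodule of cycle by <:].

Definition boundary_pred : {pred cycle} :=
  fun z => `[< exists w, cycle_val z = f w >].

Fact boundary_pred_closed : zmod_closed boundary_pred.
Proof.
split=> [|x y]; rewrite !unfold_in; first by apply/asboolP; exists 0; rewrite raddf0.
move=> /asboolP[u xu] /asboolP[v yv]; apply/asboolP; exists (u - v).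
by rewrite raddfB -xu -yv; exact: (raddfB (val : cycle -> B)).
Qed.
HB.instance Definition _ := GRing.isZmodClosed.Build cycle boundary_pred
  boundary_pred_closed.

Definition homology : zmodType := Quotient.quot boundary_pred.

Definition homology_class (z : cycle) : homology := \pi_homology z.

End Homology.

Section MagnitudeHomology.
Variables (R : realType) (V : finType) (Y : rcat R V) (r : \bar R).

Definition tuple_length n (x : n.+1.-tuple V) : \bar R :=
  (\sum_(i < n) Y (tnth x (inord i)) (tnth x (inord i.+1)))%E.

Definition simplex n := {x : n.+1.-tuple V | tuple_length x == r}.

(* [simplex n] is finite, so all its [int]-valued functions form the free
   abelian group on it. *)
Definition chain n : zmodType := {ffun simplex n -> int}.

Definition basis_chain n (t : n.+1.-tuple V) : chain n :=
  [ffun x => (val x == t)%:R].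

Definition face n (i : 'I_n.+2) (x : n.+2.-tuple V) : n.+1.-tuple V :=
  [tuple tnth x (lift i j) | j < n.+1].

(* Linear extension of [face i]; simplices whose face does not have length [r]
   contribute to no coefficient, hence are sent to 0. *)
Definition face_map n (i : 'I_n.+2) (u : chain n.+1) : chain n :=
  [ffun y : simplex n =>
     \sum_(x : simplex n.+1 | face i (val x) == val y) u x].

Definition chain_diff n (u : chain n.+1) : chain n :=
  [ffun y => \sum_(i < n.+2) (-1) ^+ i * face_map i u y].

Definition degen n (i : 'I_n.+1) (x : n.+1.-tuple V) : n.+2.-tuple V :=
  [tuple tnth x (inord (unbump i j)) | j < n.+2].

Definition degenerate n (x : n.+1.-tuple V) : bool :=
  [exists i : 'I_n, tnth x (inord i) == tnth x (inord i.+1)].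

Lemma degenerateP n (x : n.+2.-tuple V) :
  reflect (exists i y, x = degen i y) (degenerate x).
Proof.
apply: (iffP existsP) => [[i /eqP xi]|[i [y ->]]]; last first.
  have lti := ltn_ord i; exists i; rewrite !tnth_mktuple.
  by apply/eqP; congr tnth; apply: val_inj; rewrite /= !inordK /unbump; lia.
exists i; exists (@face n (inord i) x); apply: eq_from_tnth => j.
have lti := ltn_ord i; have ltj := ltn_ord j.
have ub : (unbump i j < n.+1)%N by rewrite /unbump; case: ltnP => ij; lia.
rewrite !tnth_mktuple.
have [ji|nji] := eqVneq (j : nat) i.
  have -> : j = inord i by apply: val_inj; rewrite /= inordK; lia.
  rewrite xi; congr tnth; apply: val_inj.
  by rewrite /= !inordK /bump /unbump; lia.
congr tnth; apply: val_inj; rewrite /= !inordK /bump; move: ub nji; rewrite /unbump; lia.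
Qed.

(* The span of the degenerate simplices. *)
Definition degenerate_pred n : {pred chain n} :=
  fun u => [forall x, (u x != 0) ==> degenerate (val x)].

Fact degenerate_pred_closed n : zmod_closed (@degenerate_pred n).
Proof.
split=> [|u v]; rewrite !unfold_in.
  by apply/forallP => x; rewrite ffunE eqxx.
move=> /forallP Du /forallP Dv; apply/forallP => x; apply/implyP.
rewrite !ffunE => uv0; have := Du x; have := Dv x.
have [u0|_] := eqVneq (u x) 0; last by [].
have [v0|_] := eqVneq (v x) 0; last by [].
by rewrite u0 v0 subrr eqxx in uv0.
Qed.
HB.instance Definition _ n := GRing.isZmodClosed.Build (chain n)
  (@degenerate_pred n) (@degenerate_pred_closed n).

Lemma chain_diff_zmod_morphism n : zmod_morphism (@chain_diff n).
Proof.
move=> u v; apply/ffunP => y; rewrite !ffunE -sumrB; apply: eq_bigr => i _.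
by rewrite -mulrBr !ffunE -sumrB; congr (_ * _); apply: eq_bigr => x _; rewrite !ffunE.
Qed.
HB.instance Definition _ n :=
  GRing.isZmodMorphism.Build (chain n.+1) (chain n) (@chain_diff n)
    (@chain_diff_zmod_morphism n).

Lemma chain_diff_degenerate n (u : chain n.+1) :
  u \in @degenerate_pred n.+1 -> chain_diff u \in @degenerate_pred n.
Proof.
rewrite !unfold_in => /forallP Du; apply/forallP => y; apply/implyP.
apply: contra_neqT => ndy; rewrite ffunE.
under eq_bigr => i _ do rewrite ffunE mulr_sumr big_mkcond /=.
rewrite exchange_big /=; apply: big1 => x _.
under eq_bigr => i _ do rewrite -[if _ then _ else _]mulrb.
have [->|ux0] := eqVneq (u x) 0; first by apply: big1 => i _; rewrite mulr0 mul0rn.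
have /existsP[k /eqP xk] := implyP (Du x) ux0.
have ltk := ltn_ord k.
pose i1 : 'I_n.+2 := inord k; pose i2 : 'I_n.+2 := inord k.+1.
have v1 : i1 = k :> nat by rewrite inordK //; lia.
have v2 : i2 = k.+1 :> nat by rewrite inordK //; lia.
have i21 : i2 != i1 by apply/eqP => /(congr1 val) /=; rewrite v1 v2; lia.
have face12 : face i1 (val x) = face i2 (val x).
  apply: eq_from_tnth => j; rewrite !tnth_mktuple.
  have ltj := ltn_ord j.
  have [jk|njk] := eqVneq (j : nat) k.
    have -> : lift i1 j = i2 by apply: val_inj; rewrite /= v1 v2 /bump jk; lia.
    have -> : lift i2 j = i1 by apply: val_inj; rewrite /= v1 v2 /bump jk; lia.
    by rewrite /i1 /i2 xk.
  by congr tnth; apply: val_inj; rewrite /= v1 v2 /bump; lia.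
rewrite (bigD1 i1) //= (bigD1 i2) //= big1 ?addr0 => [|i /andP[ni1 ni2]].
  by rewrite face12 v1 v2 exprS mulN1r mulNr mulNrn addrN.
case: eqP => // facei; move: ndy; rewrite [X in degenerate X](esym facei) => /negP[].
have lti := ltn_ord i.
have {}ni1 : (i : nat) != k by apply: contra_neq ni1 => ik; apply: val_inj; rewrite /= v1.
have {}ni2 : (i : nat) != k.+1 by apply: contra_neq ni2 => ik; apply: val_inj; rewrite /= v2.
have n0 : (0 < n)%N by lia.
apply/existsP; have [ik|ki] := ltnP i k.
  have ltj : (k.-1 < n)%N by lia.
  exists (Ordinal ltj); rewrite !tnth_mktuple /=; apply/eqP.
  transitivity (tnth (val x) (inord k)); [|rewrite xk];
    by congr tnth; apply: val_inj; rewrite /= !inordK /bump; lia.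
have ltj : (k < n)%N by lia.
exists (Ordinal ltj); rewrite !tnth_mktuple /=; apply/eqP.
transitivity (tnth (val x) (inord k)); [|rewrite xk];
  by congr tnth; apply: val_inj; rewrite /= !inordK /bump; lia.
Qed.

Definition moore n : zmodType := Quotient.quot (@degenerate_pred n).

Definition moore_diff n (z : moore n.+1) : moore n :=
  \pi_(moore n) (chain_diff (repr z)).

Lemma moore_diff_pi n (u : chain n.+1) :
  moore_diff (\pi_(moore n.+1) u) = \pi_(moore n) (chain_diff u).
Proof.
apply/eqP; rewrite /moore_diff -Quotient.idealrBE -raddfB.
apply: chain_diff_degenerate; rewrite Quotient.idealrBE.
by apply/eqP; exact: reprK.
Qed.

Lemma moore_diff_zmod_morphism n : zmod_morphism (@moore_diff n).
Proof.
elim/quotW=> u; elim/quotW=> v.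
by rewrite -raddfB !moore_diff_pi !raddfB.
Qed.
HB.instance Definition _ n :=
  GRing.isZmodMorphism.Build (moore n.+1) (moore n) (@moore_diff n)
    (@moore_diff_zmod_morphism n).

(* The differential out of degree [n], which is zero for [n = 0]. *)
Definition moore_out n : {additive moore n -> moore n.-1} :=
  match n with
  | 0 => \0
  | m.+1 => @moore_diff m
  end.

Definition magnitude_homology n : zmodType :=
  homology (@moore_diff n) (moore_out n).

Definition H1_generator (a b : V) : Prop :=
  [/\ a <> b, Y a b = r &
      exists z : cycle (moore_out 1),
        cycle_val z = \pi_(moore 1) (basis_chain [tuple a; b]) /\
        (homology_class (@moore_diff 1) z : magnitude_homology 1) <> 0].

End MagnitudeHomology.

(* Main.v *)
Require Import Defs.
From mathcomp Require Import all_boot all_order all_algebra.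
From mathcomp Require Import boolp classical_sets reals ereal.

(** The class of [(a, b)] in degree 1 is nonzero exactly when no third point
    lies metrically between [a] and [b]: a point [d] between them makes
    [(a, b)] the boundary of [- (a, d, b)], the two other faces being too short;
    conversely, if there is no such point, the only 2-simplices having [(a, b)]
    as a face are [(a, a, b)] and [(a, b, b)], in whose boundaries it occurs
    twice with opposite signs. As there are finitely many intermediate states,
    primitivity leaves a gap between the infimum cost of a transition from [a]
    to [b] and the costs of the composite ones. *)

Import Order.TTheory GRing.Theory Num.Theory.
Local Open Scope ring_scope.
Local Open Scope quotient_scope.

Lemma tuple2P (T : Type) (t : 2.-tuple T) : exists a b, t = [tuple a; b].
Proof.
by case/tupleP: t => a t; case/tupleP: t => b t; exists a, b;
  apply: val_inj; rewrite /= (tuple0 t).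
Qed.

Lemma tuple3P (T : Type) (t : 3.-tuple T) : exists a b d, t = [tuple a; b; d].
Proof.
case/tupleP: t => a t; case: (tuple2P _ t) => b [d ->].
by exists a, b, d; apply: val_inj.
Qed.

Lemma eq_tuple2 (T : eqType) (a b a' b' : T) :
  ([tuple a; b] == [tuple a'; b']) = (a == a') && (b == b').
Proof. by rewrite -val_eqE /= !eqseq_cons andbT. Qed.

Lemma homology_class_eq0 (A B C : zmodType) (f : {additive A -> B})
    (g : {additive B -> C}) (z : Defs.cycle g) :
  homology_class f z = 0 <-> exists w, cycle_val z = f w.
Proof.
have -> : homology_class f z = 0 <-> z \in @boundary_pred A B C f g.
  rewrite -{2}[z]subr0 Quotient.idealrBE /homology_class.
  rewrite -(raddf0 \pi_(homology f g)).
  by split => [/eqP|/eqP].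
by rewrite unfold_in; split => [/asboolP|?]; last exact/asboolP.
Qed.

Section Magnitude.
Variables (R : realType) (V : finType) (Y : rcat R V) (r : \bar R).

Lemma tuple_length1 (a : V) : tuple_length Y [tuple a] = 0%E.
Proof. by rewrite /tuple_length big_ord0. Qed.

Lemma tuple_length2 (a b : V) : tuple_length Y [tuple a; b] = Y a b.
Proof.
rewrite /tuple_length !big_ord_recl big_ord0 adde0.
by rewrite !(tnth_nth a) /= !inordK.
Qed.

Lemma tuple_length3 (a b d : V) :
  tuple_length Y [tuple a; b; d] = (Y a b + Y b d)%E.
Proof.
rewrite /tuple_length !big_ord_recl big_ord0 adde0.
by rewrite !(tnth_nth a) /= !inordK.
Qed.

(** Exchanging the sums turns the differential into a matrix of signed incidence numbers; a face of
    length other than [r] equals no simplex [y] and contributes nothing. *)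
Lemma chain_diffE n (u : chain Y r n.+1) (y : simplex Y r n) :
  chain_diff u y =
  \sum_x (\sum_(i < n.+2) (-1) ^+ i * (face i (val x) == val y)%:R) * u x.
Proof.
rewrite ffunE.
under eq_bigr => i _ do rewrite ffunE mulr_sumr big_mkcond /=.
rewrite exchange_big /=; apply: eq_bigr => x _; rewrite mulr_suml.
by apply: eq_bigr => i _; case: eqP => _; rewrite ?mulr1 ?mulr0 ?mul0r.
Qed.

Lemma chain_diff_basis n (x : simplex Y r n.+1) (y : simplex Y r n) :
  chain_diff (basis_chain Y r (val x)) y =
  \sum_(i < n.+2) (-1) ^+ i * (face i (val x) == val y)%:R.
Proof.
rewrite chain_diffE (bigD1 x) // [X in (_ + X)%R = _]big1.
  by rewrite ffunE eqxx mulr1 addr0.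
by move=> x' x'x; rewrite ffunE val_eqE (negPf x'x) mulr0.
Qed.

Lemma face_sum_tuple3 (a b d : V) (t : 2.-tuple V) :
  \sum_(i < 3) (-1) ^+ i * (face i [tuple a; b; d] == t)%:R =
  ([tuple b; d] == t)%:R - ([tuple a; d] == t)%:R + ([tuple a; b] == t)%:R :> int.
Proof.
rewrite !big_ord_recl big_ord0 addr0 /= expr0 mul1r expr1 mulN1r.
rewrite expr2 mulrNN !mul1r addrA; congr (_ - _ + _); congr (_ == _)%:R;
  by apply: eq_from_tnth => -[[|[|//]] j2]; rewrite tnth_mktuple !(tnth_nth a).
Qed.

(** Undoes both quotients, so that nonvanishing of the class becomes a question about coefficients
    of unnormalized chains. *)
Lemma H1_generatorP (a b : V) : (0 < r)%E ->
  H1_generator Y r a b <->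
  [/\ a <> b, Y a b = r &
      forall u : chain Y r 2,
        basis_chain Y r [tuple a; b] - chain_diff u
          \notin @degenerate_pred R V Y r 1].
Proof.
move=> r0.
have pi_eq (u v : chain Y r 1) :
    \pi_(moore Y r 1) u = \pi v <-> u - v \in @degenerate_pred R V Y r 1.
  by rewrite Quotient.idealrBE; split => /eqP.
split=> [[ab Yab [z [zab z0]]]|[ab Yab nu]]; split=> //.
  move=> u; apply/negP => /pi_eq uab; apply: z0; apply/homology_class_eq0.
  by exists (\pi_(moore Y r 2) u); rewrite /= moore_diff_pi zab.
(* A 0-simplex has length 0 while [r] is positive, so the chains of degree 0 vanish and every
   1-chain is a cycle. *)
have cyc : \pi_(moore Y r 1) (basis_chain Y r [tuple a; b])
    \in @cycle_pred _ _ (moore_out Y r 1).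
  rewrite unfold_in /= moore_diff_pi; apply/eqP.
  rewrite -(raddf0 \pi_(moore Y r 0)); congr (\pi _); apply/ffunP => -[y len_y].
  case/tupleP: y len_y => x y; rewrite (tuple0 y) => len_y; exfalso.
  by move: r0; rewrite -(eqP len_y) tuple_length1 ltxx.
exists (Cycle cyc); split=> // /homology_class_eq0 [w] /=.
elim/quotW: w => u; rewrite moore_diff_pi => /pi_eq.
exact/negP.
Qed.

Lemma cost_primitive_H1_generator (a b : V) : strict Y ->
  (0 < r)%E -> (r < +oo)%E -> Y a b = r ->
  H1_generator Y r a b <-> cost_primitive Y a b.
Proof.
move=> Ystrict r0 roo Yab; rewrite H1_generatorP //.
have fin_le (x : \bar R) : (0 <= x -> x <= r -> x \is a fin_num)%E.
  by move=> x0 xr; rewrite ge0_fin_numE // (le_lt_trans xr).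
have Ygt0 x y : x <> y -> (0 < Y x y)%E.
  move=> xy; rewrite lt_neqAle dist_ge0 andbT eq_sym.
  by apply/eqP => /Ystrict.
split=> [[ab _ nu]|[ab prim]]; split=> //.
  move=> [d [da db Yadb]].
  have len : tuple_length Y [tuple a; d; b] == r by rewrite tuple_length3 -Yadb Yab.
  (* Strictness makes the second summand positive; as the total [r] is finite, the first lies
     strictly below it. *)
  have short x y z w : Y a b = (Y x y + Y z w)%E -> z <> w -> Y x y != r.
    move=> Yxyzw /Ygt0 zw; apply: contraTneq (lexx r) => Yxy.
    rewrite -ltNge -{2}Yab Yxyzw Yxy lteDl // fin_le //; exact: ltW.
  (* Omitting the middle vertex carries the sign -1, hence the minus sign here: without the outer
     faces the difference is the zero chain. *)
  have := nu (- basis_chain Y r [tuple a; d; b]); rewrite raddfN opprK.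
  apply/negP/negPn; rewrite unfold_in; apply/forallP => y; apply/implyP.
  have /eqP len_y := valP y.
  pose adb : simplex Y r 2 := exist _ [tuple a; d; b] len.
  apply: contraNT => _; rewrite ffunE (chain_diff_basis _ adb) face_sum_tuple3.
  rewrite ffunE [val y == _]eq_sym.
  have -> : ([tuple d; b] == val y) = false.
    apply: contra_eqF len_y => /eqP <-; rewrite tuple_length2.
    by apply: (short _ _ a d); [rewrite addeC | exact/nesym].
  have -> : ([tuple a; d] == val y) = false.
    apply: contra_eqF len_y => /eqP <-; rewrite tuple_length2.
    exact: (short _ _ d b).
  by rewrite addr0 sub0r addrN.
move=> u; rewrite unfold_in; apply/forallPn.
have len : tuple_length Y [tuple a; b] == r by rewrite tuple_length2 Yab.
(* The coefficient at [(a, b)] decides: this simplex is nondegenerate, and subtracting a boundary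
   leaves its coefficient 1 unchanged. *)
exists (exist _ [tuple a; b] len); rewrite negb_imply; apply/andP; split; last first.
  apply/existsPn => i; rewrite !(tnth_nth a) ord1 /= !inordK //=.
  exact/eqP.
rewrite 2!ffunE [(- _ : chain _ _ _) _]ffunE chain_diffE eqxx big1 ?subr0 //.
move=> -[x /= lenx] _; rewrite [X in X * _ = 0](_ : _ = 0) ?mul0r //.
have [x0 [x1 [x2 xE]]] := tuple3P _ x.
move: lenx; rewrite xE tuple_length3 face_sum_tuple3 !eq_tuple2 => /eqP len3.
have rfin : r \is a fin_num by rewrite fin_le // ltW.
have cancel (s : \bar R) : (s + r = r -> s = 0)%E.
  by move=> sr; rewrite -(addeK s rfin) sr subee.
(* An outer face equal to [(a, b)] uses up the whole length [r], so the remaining edge has length 0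
   and strictness collapses it. *)
have first_id : x1 = a -> x2 = b -> x0 = a.
  move=> x1a x2b; apply/Ystrict/cancel.
  by rewrite -[in LHS]Yab -x1a -x2b.
have last_id : x0 = a -> x1 = b -> x2 = b.
  move=> x0a x1b; apply/esym/Ystrict/cancel.
  by rewrite -[in LHS]Yab -x1b -x0a addeC.
have middle : x0 = a -> x2 = b -> x1 = a \/ x1 = b.
  move=> x0a x2b; have [|x1a] := pselect (x1 = a); first by left.
  have [|x1b] := pselect (x1 = b); first by right.
  by case: prim; exists x1; split=> //; rewrite Yab -len3 x0a x2b.
(* Only [(a, a, b)] and [(a, b, b)] have [(a, b)] as a face; in each the middle face cancels exactly
   one outer face. *)
have [x0a|x0a] := x0 =P a; have [x1a|x1a] := x1 =P a;
  have [x1b|x1b] := x1 =P b; have [x2b|x2b] := x2 =P b => //=;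
  exfalso; intuition congruence.
Qed.

End Magnitude.

Lemma induced_lt (R : realType) (M : monoidType) (c : cost_functor R M)
    (A : set M) (t : \bar R) :
  (induced c A < t)%E -> exists2 m, A m & (c m < t)%E.
Proof. by move=> /ereal_inf_lt [_ [m Am <-] cmt]; exists m. Qed.

(** A finite infimum forces [A] to be nonempty; were it not attained, the costs on [A] would
    contradict discreteness. *)
Lemma induced_attained (R : realType) (M : monoidType) (c : cost_functor R M)
    (A : set M) : discrete_range c -> (induced c A < +oo)%E ->
  exists2 m, A m & c m = induced c A.
Proof.
move=> discr /induced_lt [m Am _]; apply: contrapT => not_attained.
apply: discr; exists (induced c A), [set c n | n in A]%classic; split=> //.
  by exists (c m), m.
by move=> _ [n _ <-]; exists n.
Qed.

(* If there are no intermediate states, the bound [t] is [+oo], and finiteness of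
   the cost provides the transition. *)
Lemma cost_primitive_transition (R : realType) (M : monoidType)
    (c : cost_functor R M) (V : finType) (X : automaton M V) (a b : V) :
  cost_primitive (induced_rcat c X) a b -> (induced c (X a b) < +oo)%E ->
  exists2 m, X a b m & forall m', composite X a b m' -> (c m < c m')%E.
Proof.
move=> [_ prim] fin_ab.
pose s d := (induced c (X a d) + induced c (X d b))%E.
pose t := \big[Order.min/+oo%E]_(d | (d != a) && (d != b)) s d.
(* By primitivity each [s d] lies strictly above the infimum cost from [a] to [b], hence so does the
   minimum of these finitely many values. *)
have [|m Xm cm] := @induced_lt _ _ c (X a b) t.
  rewrite /t; elim/big_ind: _ => // [x y ltx lty|d /andP[/eqP da /eqP db]].
    by rewrite lt_min ltx.
  rewrite lt_neqAle induced_triangle andbT.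
  by apply/eqP => abd; apply: prim; exists d.
exists m => // _ [d [m1 [m2 [da db Xm1 Xm2 ->]]]].
apply: (lt_le_trans cm); apply: (@le_trans _ _ (s d)).
  by apply: bigmin_le_cond; apply/andP; split; apply/eqP.
by rewrite costM addeC; apply: leeD; apply: induced_le.
Qed.

(** Through a state [d] violating primitivity both legs have finite, hence attained, infima; their
    composite costs exactly the infimum from [a] to [b], so it cannot cost more than [m]. *)
Lemma transition_cost_primitive (R : realType) (M : monoidType)
    (c : cost_functor R M) (V : finType) (X : automaton M V) (a b : V) m :
  discrete_range c -> a <> b -> (induced c (X a b) < +oo)%E -> X a b m ->
  (forall m', composite X a b m' -> (c m < c m')%E) ->
  cost_primitive (induced_rcat c X) a b.
Proof.
move=> discr ab fin_ab Xm lt_m; split=> // -[d [da db /= abd]].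
have [m1 Xm1 cm1] : exists2 m, X a d m & c m = induced c (X a d).
  apply: induced_attained => //; apply: le_lt_trans fin_ab.
  by rewrite abd leeDl // induced_ge0.
have [m2 Xm2 cm2] : exists2 m, X d b m & c m = induced c (X d b).
  apply: induced_attained => //; apply: le_lt_trans fin_ab.
  by rewrite abd leeDr // induced_ge0.
have /lt_m : composite X a b (m2 * m1)%g by exists d, m1, m2.
by rewrite costM cm1 cm2 addeC -abd ltNge induced_le.
Qed.

Local Open Scope ring_scope.
Local Open Scope ereal_scope.

Theorem proposition28 (R : realType) (M : monoidType) (c : cost_functor R M)
    (V : finType) (X : automaton M V) (r : \bar R) :
  strict (induced_rcat c X) -> 0 < r -> r < +oo ->
  (forall a b : V, H1_generator (induced_rcat c X) r a b ->
     exists m : M,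
       [/\ X a b m, ~ composite X a b m &
           forall m' : M, composite X a b m' -> c m < c m']) /\
  (discrete_range c ->
   forall a b : V, induced_rcat c X a b = r ->
     (exists m : M, X a b m /\
        forall m' : M, composite X a b m' -> c m < c m') ->
     cost_primitive (induced_rcat c X) a b /\
     H1_generator (induced_rcat c X) r a b).
Proof.
move=> Xstrict r0 roo; split=> [a b gen|discr a b Xab [m [Xm lt_m]]].
  have [_ Xab _] := gen.
  have [m Xm lt_m] : exists2 m, X a b m &
      forall m', composite X a b m' -> c m < c m'.
    apply: cost_primitive_transition; last by move: Xab => /= ->.
    exact/(cost_primitive_H1_generator _ _ _ _ _ _ Xstrict r0 roo Xab).
  (* Were [m] itself composite, it would cost strictly less than itself. *)
  by exists m; split=> // /lt_m; rewrite ltxx.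
have prim : cost_primitive (induced_rcat c X) a b.
  apply: (@transition_cost_primitive _ _ _ _ _ _ _ m) => //.
    by move=> ab; move: r0; rewrite -Xab ab dist_refl ltxx.
  by move: Xab => /= ->.
by split=> //; apply/(cost_primitive_H1_generator _ _ _ _ _ _ Xstrict r0 roo Xab).
Qed.
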